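(* Let $P$ be an Eulerian poset. Let $\widehat{P}$ be the poset of all closed intervals of $P$, including the empty set, ordered by reverse inclusion. Then the $Z$-polynomial of $P$ with respect to the Eulerian kernel equals the toric $h$-polynomial of $\widehat{P}$, i.e. $Z_P(x) = h_{\widehat{P}}(x)$.
   Context: All posets are finite and bounded, with minimum $\widehat{0}$ and maximum $\widehat{1}$. A poset $P$ is graded if all its maximal chains have the same length; its rank function is denoted $\rho$, with $\rho(\widehat 0)=0$, and $\rho_{st}=\rho(t)-\rho(s)$ for $s\le t$. A graded bounded poset is Eulerian if its Möbius function satisfies $\mu_{st}=(-1)^{\rho_{st}}$ for all $s\le t$. Incidence algebra: $\mathcal{I}(P)$ is the set of functions $a$ assigning to each nonempty closed interval $[s,t]$ of $P$ a polynomial $a_{st}(x)\in\mathbb{Z}[x]$, with product $(ab)_{st}=\sum_{s\le w\le t}a_{sw}b_{wt}$. $\mathcal{I}_\rho(P)$ is the subalgebra of those $a$ with $\deg a_{st}\le\rho_{st}$ for all $s\le t$; on it there is the involution $(a^{\mathrm{rev}})_{st}(x)=x^{\rho_{st}}a_{st}(x^{-1})$. If $P$ is Eulerian, the Eulerian kernel is $\varepsilon\in\mathcal{I}_\rho(P)$, $\varepsilon_{st}(x)=(x-1)^{\rho_{st}}$. The right KLS function is the unique $f\in\mathcal{I}_\rho(P)$ with $f_{ss}=1$ for all $s$, $\deg f_{st}<\frac12\rho_{st}$ for all $s<t$, and $f^{\mathrm{rev}}=\varepsilon f$. The left KLS function is the unique $g\in\mathcal{I}_\rho(P)$ with $g_{ss}=1$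 for all $s$, $\deg g_{st}<\frac12\rho_{st}$ for all $s<t$, and $g^{\mathrm{rev}}=g\varepsilon$. (Existence and uniqueness of both are known.) The $Z$-function is $Z=g^{\mathrm{rev}}f=gf^{\mathrm{rev}}\in\mathcal{I}_\rho(P)$, and the $Z$-polynomial of $P$ is $Z_P(x)=Z_{\widehat0\,\widehat1}(x)$. The toric $g$-polynomial of $P$ is $g_P(x)=g_{\widehat0\,\widehat1}(x)$, and the toric $h$-polynomial of $P$ is $h_P(x)=\dfrac{g_P^{\mathrm{rev}}(x)-g_P(x)}{x-1}$, where $g_P^{\mathrm{rev}}=(g^{\mathrm{rev}})_{\widehat0\,\widehat1}$. Poset of intervals: $\widehat{P}=\{[s,t]: s\le t \text{ in } P\}\cup\{\varnothing\}$ ordered by reverse inclusion; its minimum is $[\widehat0,\widehat1]=P$ and its maximum is $\varnothing$. By a theorem of Lindström, $\widehat{P}$ is Eulerian whenever $P$ is, so its toric $h$-polynomial is defined: writing $\widehat\rho$ for the rank function of $\widehat P$, $\widehat\varepsilon_{I,J}(x)=(x-1)^{\widehat\rho_{I,J}}$ for the Eulerian kernel of $\widehat P$, and $\widehat g$ for the left KLS function of $\widehat P$ (the unique $\widehat g\in\mathcal{I}_{\widehat\rho}(\widehat P)$ with $\widehat g_{I,I}=1$ for all $I$, $\deg\widehat g_{I,J}<\frac12\widehat\rho_{I,J}$ for all $I<J$ in $\widehat P$, and $\widehat g^{\mathrm{rev}}=\widehat g\,\widehat\varepsilon$), it is $h_{\widehat P}(x)=\dfrac{(\widehat g^{\mathrm{rev}})_{[\widehat0,\widehat1],\varnothing}(x)-\widehat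 g_{[\widehat0,\widehat1],\varnothing}(x)}{x-1}$. *)

(* Defs.v *)
From HB Require Import structures.
From mathcomp Require Import all_boot all_order all_algebra.

Set Implicit Arguments.
Unset Strict Implicit.
Unset Printing Implicit Defensive.

Import Order.TTheory GRing.Theory.

Local Open Scope order_scope.

Section BoundedPosets.
Context {d : Order.disp_t} {P : finTBPOrderType d}.
Implicit Types (s t w : P) (C : {set P}).

Definition cinterval s t : {set P} := [set w | s <= w <= t].

Definition is_chain C : bool := [forall x in C, forall y in C, x >=< y].

(* A chain of length n has n + 1 elements, so comparing lengths of (nonempty)
   maximal chains amounts to comparing cardinals. *)
Definition graded : Prop :=
  forall C C' : {set P},
    maxset is_chain C -> maxset is_chain C' -> #|C| = #|C'|.

(* Length of the longest chain in [\bot, t]; when P is graded, all the maximal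
   chains of [\bot, t] have this length. *)
Definition rank t : nat :=
  (\max_(C : {set P} | is_chain C && (C \subset cinterval \bot t)) #|C|).-1.

Definition rk s t : nat := rank t - rank s.

(* The first argument bounds the depth of the recursion; #|P| is always enough,
   see mobiusE. *)
Fixpoint mobius_rec (n : nat) s t : int :=
  if n isn't n'.+1 then 0%R
  else if s == t then 1%R
  else (- \sum_(w : P | (s <= w < t)%O) mobius_rec n' s w)%R.

Definition mobius s t : int := mobius_rec #|P| s t.

Definition eulerian : Prop :=
  graded /\ forall s t, s <= t -> mobius s t = ((- 1) ^+ rk s t)%R.

End BoundedPosets.

Arguments graded {d} P.
Arguments eulerian {d} P.

Lemma mobius_rec_stable d (P : finTBPOrderType d) n m (s t : P) :
  (#|[set w : P | (s <= w < t)%O]| < n)%N ->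
  (#|[set w : P | (s <= w < t)%O]| < m)%N ->
  mobius_rec n s t = mobius_rec m s t.
Proof.
elim: n m t => [|n IHn] [|m] t //= ltn ltm.
case: ifP => // _; congr (- _)%R; apply: eq_bigr => w /andP[sw wt].
have lt_card :
    (#|[set v : P | (s <= v < w)%O]| < #|[set v : P | (s <= v < t)%O]|)%N.
  apply: proper_card; apply/properP; split.
    by apply/subsetP => v; rewrite !inE => /andP[-> /lt_trans->].
  by exists w; rewrite !inE ?sw ?wt // ltxx andbF.
by apply: IHn; apply: leq_trans lt_card _.
Qed.

Lemma mobiusE d (P : finTBPOrderType d) (s t : P) :
  mobius s t =
    if s == t then 1%R else (- \sum_(w : P | (s <= w < t)%O) mobius s w)%R.
Proof.
have lt_card (u : P) : (#|[set w : P | (s <= w < u)%O]| < #|P|)%N.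
  rewrite -cardsT; apply: proper_card; apply/properP; split=> //.
  by exists u; rewrite ?inE // ltxx andbF.
rewrite {1}/mobius (@mobius_rec_stable _ _ _ #|P|.+1 s t (lt_card t)) //.
by rewrite ltnS; apply: ltnW; apply: lt_card.
Qed.

Section IncidenceAlgebra.
Context {d : Order.disp_t} {P : finTBPOrderType d}.

(* Only the values a s t with s <= t are meaningful: every definition below
   restricts to such pairs. *)
Definition incidence : Type := P -> P -> {poly int}.

Implicit Types (a b f g k : incidence) (s t : P).

Definition conv a b : incidence :=
  fun s t => (\sum_(w : P | (s <= w <= t)%O) a s w * b w t)%R.

Definition eq_incidence a b : Prop := forall s t, s <= t -> a s t = b s t.

(* deg (a s t) <= rk s t, where size p is deg p + 1 for p != 0 and size 0 = 0 *)
Definition in_Irho a : Prop :=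
  forall s t, s <= t -> (size (a s t) <= (rk s t).+1)%N.

(* x ^ n * p(1/x), for deg p <= n *)
Definition revp (n : nat) (p : {poly int}) : {poly int} :=
  (\poly_(i < n.+1) p`_(n - i))%R.

Definition inc_rev a : incidence := fun s t => revp (rk s t) (a s t).

Definition eulerian_kernel : incidence :=
  fun s t => (('X - 1) ^+ rk s t)%R.

(* The strict degree bound also accepts a zero value, since rk s t > 0 for
   s < t. *)
Definition kls_normalized a : Prop :=
  [/\ in_Irho a,
      forall s, a s s = 1%R
    & forall s t, s < t -> (2 * (size (a s t)).-1 < rk s t)%N].

Definition is_right_kls k f : Prop :=
  kls_normalized f /\ eq_incidence (inc_rev f) (conv k f).

Definition is_left_kls k g : Prop :=
  kls_normalized g /\ eq_incidence (inc_rev g) (conv g k).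

Definition Z_function g f : incidence := conv (inc_rev g) f.

Definition Z_poly g f : {poly int} := Z_function g f \bot \top.

(* 'X - 1 is monic, so %/ is Euclidean division in {poly int}; for the left
   KLS function g of the Eulerian kernel and \bot < \top it is exact. *)
Definition toric_h g : {poly int} :=
  ((inc_rev g \bot \top - g \bot \top) %/ ('X - 1))%R.

End IncidenceAlgebra.

Arguments incidence {d} P.
Arguments eulerian_kernel {d} P.

Section IntervalPoset.
Context {d : Order.disp_t} {P : finTBPOrderType d}.

Definition is_closed_interval (A : {set P}) : bool :=
  (A == set0) || [exists s : P, exists t : P, (s <= t) && (A == cinterval s t)].

Lemma is_closed_interval0 : is_closed_interval set0.
Proof. by rewrite /is_closed_interval eqxx. Qed.

Lemma is_closed_intervalT : is_closed_interval (cinterval \bot \top).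
Proof.
apply/orP; right; apply/existsP; exists \bot; apply/existsP; exists \top.
by rewrite le0x eqxx.
Qed.

End IntervalPoset.

Record intervals {d : Order.disp_t} (P : finTBPOrderType d) : Type := ClosedInterval {
  interval_set : {set P};
  interval_setP : is_closed_interval interval_set
}.

Fact intervals_display : Order.disp_t.
Proof. exact: Order.Disp tt tt. Qed.

Section IntervalPosetInstances.
Context {d : Order.disp_t} {P : finTBPOrderType d}.
Implicit Types A B : intervals P.

HB.instance Definition _ := [isSub for @interval_set d P].
HB.instance Definition _ := [Finite of intervals P by <:].

Definition intervals_le A B : bool := interval_set B \subset interval_set A.

Fact intervals_le_refl : reflexive intervals_le.
Proof. by move=> A; apply: subxx. Qed.

Fact intervals_le_anti : antisymmetric intervals_le.
Proof.
by move=> A B /andP[BA AB]; apply/val_inj/eqP; rewrite eqEsubset; apply/andP.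
Qed.

Fact intervals_le_trans : transitive intervals_le.
Proof. by move=> B A C BA CB; apply: subset_trans CB BA. Qed.

HB.instance Definition _ :=
  Order.Le_isPOrder.Build intervals_display (intervals P)
    intervals_le_refl intervals_le_anti intervals_le_trans.

Definition intervals_bot : intervals P := ClosedInterval is_closed_intervalT.
Definition intervals_top : intervals P := ClosedInterval is_closed_interval0.

Fact intervals_le0x A : intervals_bot <= A.
Proof. by apply/subsetP => w _; rewrite inE le0x lex1. Qed.

Fact intervals_lex1 A : A <= intervals_top.
Proof. exact: sub0set. Qed.

HB.instance Definition _ :=
  Order.hasBottom.Build intervals_display (intervals P) intervals_le0x.
HB.instance Definition _ :=
  Order.hasTop.Build intervals_display (intervals P) intervals_lex1.

End IntervalPosetInstances.

(* Main.v *)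
Require Import Defs.
From mathcomp Require Import all_boot all_order all_algebra.
From mathcomp Require Import zify.

(** Moving up in the poset of intervals from [s, t] to a nonempty [u, v] means
    moving s up to u and t down to v, so the interval between these two
    elements is the product of [s, u] with the dual of [v, t].  Left KLS
    functions of Eulerian kernels are multiplicative over products, and
    dualizing exchanges left and right.  Hence
        ghat_([s, t], [u, v]) = g_(s, u) f_(v, t)             [left_kls_itv].
    This is proved without isomorphisms: the right-hand side satisfies the
    recursion and the degree bounds that determine ghat, because reversal is
    multiplicative [revpM] and because a polynomial of degree < n/2 can be read
    off the difference between its reversal and itself [revp_sub_inj].

    Now write the relation ghat^rev = ghat * eps between the minimum and the
    maximum (the empty interval).  The term indexed by the empty interval is
    ghat itself, and [u, v] has corank rho_(u, v) + 1, so
        ghat^rev - ghat = sum_(u <= v) g_(0, u) (x - 1)^(rho_(u, v) + 1) f_(v, 1)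
                        = (x - 1) (g eps f)_(0, 1) = (x - 1) (g^rev f)_(0, 1),
    which is (x - 1) Z [left_kls_rev_sub].

    What remains is order theory: the rank of [u, v] among intervals is
    rho_(0, u) + rho_(v, 1) [rank_intervals].  Ranks are defined by longest
    chains; they are recognized by strict monotonicity together with the
    existence of predecessors of rank one less [rank_unique].  Gradedness of P
    supplies the steps that shrink an interval from its upper end
    [rank_succ]. *)

Set Implicit Arguments.
Unset Strict Implicit.
Unset Printing Implicit Defensive.

Import Order.TTheory GRing.Theory.

Local Open Scope order_scope.

(** * Ranks in graded posets *)

Section Rank.
Context {d : Order.disp_t} {P : finTBPOrderType d}.
Implicit Types (s t u v w x y z : P) (C : {set P}).

Lemma is_chainP C :
  reflect {in C &, forall x y, x >=< y} (is_chain C).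
Proof.
apply: (iffP forall_inP) => [cC x y xC yC|cC x xC].
  by move/forall_inP: (cC x xC) => /(_ y yC).
by apply/forall_inP => y yC; apply: cC.
Qed.

Lemma is_chainU C C' :
  is_chain C -> is_chain C' -> {in C & C', forall x y, x <= y} ->
  is_chain (C :|: C').
Proof.
move=> /is_chainP cC /is_chainP cC' leCC'; apply/is_chainP => x y.
rewrite !inE => /orP[xC|xC'] /orP[yC|yC']; first exact: cC.
- by rewrite le_comparable ?leCC'.
- by rewrite comparable_sym le_comparable ?leCC'.
- exact: cC'.
Qed.

Lemma is_chain1 x : is_chain [set x].
Proof. by apply/is_chainP => y z /set1P-> /set1P->; apply: comparablexx. Qed.

Lemma sub_is_chain C C' : C' \subset C -> is_chain C -> is_chain C'.
Proof.
move=> /subsetP sCC' /is_chainP cC; apply/is_chainP => x y /sCC' xC /sCC' yC.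
exact: cC.
Qed.

Let good t C := is_chain C && (C \subset cinterval \bot t).

(** Removes the predecessor in the definition of the rank: some chain below t is
    nonempty. *)
Lemma rank_succE t :
  (rank t).+1 = \max_(C : {set P} | good t C) #|C|.
Proof.
rewrite /rank prednK //; apply: leq_trans (leq_bigmax_cond [set t] _).
  by rewrite cards1.
by rewrite is_chain1 sub1set inE le0x lexx.
Qed.

Lemma card_chain_rank t C :
  is_chain C -> {in C, forall x, x <= t} -> (#|C| <= (rank t).+1)%N.
Proof.
move=> cC leCt; rewrite rank_succE; apply: (leq_bigmax_cond C).
by rewrite /good cC; apply/subsetP => x /leCt xt; rewrite inE le0x.
Qed.

Lemma longest_chain t :
  exists2 C, is_chain C /\ {in C, forall x, x <= t} & #|C| = (rank t).+1.
Proof.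
rewrite rank_succE; case: (@eq_bigmax_cond _ (good t) (fun C => #|C|)) => [|C].
  apply/card_gt0P; exists [set t].
  by rewrite unfold_in /good is_chain1 sub1set inE le0x lexx.
rewrite unfold_in => /andP[cC /subsetP sC] ->; exists C => //; split=> // x xC.
by have := sC x xC; rewrite inE => /andP[].
Qed.

Lemma rank_lt s t : s < t -> (rank s < rank t)%N.
Proof.
move=> st; have [C [cC leCs] cardC] := longest_chain s.
have tNC : t \notin C.
  by apply/negP => /leCs ts; have := lt_le_trans st ts; rewrite ltxx.
rewrite -ltnS -cardC -[leqLHS]/(1 + #|C|)%N.
have <- : #|t |: C| = (1 + #|C|)%N by rewrite cardsU1 tNC.
apply: card_chain_rank.
  rewrite setUC; apply: is_chainU => //; first exact: is_chain1.
  by move=> x y /leCs xs /set1P->; apply: le_trans xs (ltW st).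
by move=> x /setU1P[->//|/leCs xs]; apply: le_trans xs (ltW st).
Qed.

Lemma rank_le s t : s <= t -> (rank s <= rank t)%N.
Proof. by rewrite le_eqVlt => /orP[/eqP->//|/rank_lt/ltnW]. Qed.

Lemma rank0 : rank (\bot : P) = 0%N.
Proof.
have [C [_ leC] cardC] := longest_chain \bot.
apply/eqP; rewrite -leqn0 -ltnS -cardC -(cards1 (\bot : P)).
by apply/subset_leq_card/subsetP => x /leC; rewrite lex0 inE.
Qed.

(** Delete x from a longest chain ending at x: what is left is a chain below
    its element of largest rank. *)
Lemma rank_pred x : x != \bot -> exists2 y, y < x & rank x = (rank y).+1.
Proof.
move=> xN0; have [C [cC leCx] cardC] := longest_chain x.
have x_gt0 : (0 < rank x)%N by rewrite -rank0 rank_lt // lt0x.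
have /card_gt0P[y0 y0C] : (0 < #|C :\ x|)%N.
  by have := cardsD1 x C; case: (x \in C); lia.
have [y yC ymax] := @arg_maxnP _ y0 (mem (C :\ x)) rank y0C.
have /setD1P[yNx yC'] : y \in C :\ x by [].
have yx : y < x by rewrite lt_neqAle yNx leCx.
exists y => //; apply/eqP; rewrite eqn_leq rank_lt // andbT.
have : (#|C :\ x| <= (rank y).+1)%N.
  apply: card_chain_rank; first exact: sub_is_chain (subsetDl _ _) cC.
  move=> z zC; have zC' : z \in C by case/setD1P: zC.
  have /orP[//|] := is_chainP _ cC z y zC' yC'.
  rewrite le_eqVlt => /predU1P[->//|/rank_lt].
  by rewrite ltnNge (ymax z zC : (_ <= _)%N).
by have := cardsD1 x C; case: (x \in C); lia.
Qed.

(** Going down along the predecessors of phi reaches the minimum in phi x steps,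
    and psi drops at every one of them. *)
Lemma pred_le_monotone (phi psi : P -> nat) :
  phi \bot = 0%N ->
  (forall x, x != \bot -> exists2 y, y < x & phi x = (phi y).+1) ->
  {homo psi : x y / x < y >-> (x < y)%N} ->
  forall x, (phi x <= psi x)%N.
Proof.
move=> phi0 phiP psiP x; move: {2}(phi x) (leqnn (phi x)) => n.
elim: n x => [|n IHn] x; first by rewrite leqn0 => /eqP->.
have [->|/phiP[y yx ->]] := eqVneq x \bot; first by rewrite phi0.
by rewrite ltnS => /IHn/leq_ltn_trans; apply; apply: psiP.
Qed.

(** Lets the rank function of the poset of intervals be identified without
    looking at its chains: rank and phi each dominate the other, by
    [pred_le_monotone]. *)
Lemma rank_unique (phi : P -> nat) :
  phi \bot = 0%N -> {homo phi : x y / x < y >-> (x < y)%N} ->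
  (forall x, x != \bot -> exists2 y, y < x & phi x = (phi y).+1) ->
  phi =1 rank.
Proof.
move=> phi0 phi_lt phiP x; apply/eqP; rewrite eqn_leq.
rewrite (pred_le_monotone phi0 phiP rank_lt).
exact: pred_le_monotone rank0 rank_pred phi_lt x.
Qed.

(** Replacing the part of C below v by a longest chain below v gives a chain; by
    gradedness it cannot have more elements than C. *)
Lemma card_maxchain_below C v :
  graded P -> maxset is_chain C -> v \in C ->
  #|[set x in C | x <= v]| = (rank v).+1.
Proof.
move=> gP maxC vC; have [cC _] := maxsetP maxC.
set B := [set x in C | x <= v]; set A := C :\: B.
have sBC : B \subset C by apply/subsetP => x; rewrite inE => /andP[].
have cB : is_chain B by apply: sub_is_chain cC.
have cA : is_chain A by apply: sub_is_chain cC; apply: subsetDl.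
have gtA x : x \in A -> v < x.
  rewrite !inE; case: (boolP (x \in C)) => //= xC; rewrite andbT => xNv.
  have /orP[|//] := is_chainP _ cC x v xC vC; first by rewrite (negPf xNv).
  by rewrite lt_neqAle => ->; rewrite andbT; apply: contraNneq xNv => ->.
have [D [cD leDv] cardD] := longest_chain v.
apply/eqP; rewrite eqn_leq card_chain_rank //=; last by move=> x; rewrite inE => /andP[].
have cDA : is_chain (D :|: A).
  by apply: is_chainU => // x y /leDv xv /gtA/ltW; apply: le_trans.
have [M maxM sDM] := maxset_exists cDA.
have := subset_leq_card sDM; rewrite (gP _ _ maxM maxC) cardsU.
have -> : D :&: A = set0.
  apply/setP => x; rewrite in_setI in_set0; apply/negP => /andP[/leDv xv /gtA vx].
  by have := lt_le_trans vx xv; rewrite ltxx.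
have := cardsID B C; rewrite -/A.
have -> : C :&: B = B by apply/setIidPr.
by move=> <-; rewrite cardD cards0 subn0 leq_add2r.
Qed.

(** Dual to [rank_pred], but gradedness matters here: z is an element of least
    rank above v, hence covers v, and a maximal chain through v and z has
    exactly one more element below z than below v. *)
Lemma rank_succ v :
  graded P -> v != \top -> exists2 z, v < z & rank z = (rank v).+1.
Proof.
move=> gP vN1; have v1 : v < \top by rewrite ltx1.
have [z vz zmin] := @arg_minnP _ \top (fun z => v < z) rank v1.
exists z => //.
have cvz : is_chain ([set v] :|: [set z]).
  apply: is_chainU; rewrite ?is_chain1 //.
  by move=> x y /set1P-> /set1P->; apply: ltW.
have [C maxC /subsetP sC] := maxset_exists cvz; have [cC _] := maxsetP maxC.
have vC : v \in C by rewrite sC // !inE eqxx.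
have zC : z \in C by rewrite sC // !inE eqxx orbT.
apply/eqP; rewrite -eqSS -!(card_maxchain_below gP maxC) //.
set B := [set x in C | x <= v].
have -> : [set x in C | x <= z] = z |: B.
  apply/setP => x; rewrite !inE; have [->|xNz] := eqVneq x z.
    by rewrite zC lexx.
  case: (boolP (x \in C)) => //= xC; apply/idP/idP => [xz|]; last first.
    by move/le_trans; apply; apply: ltW.
  have /orP[//|] := is_chainP _ cC x v xC vC.
  rewrite le_eqVlt => /predU1P[->//|/zmin].
  by rewrite leqNgt rank_lt // lt_neqAle xNz.
by rewrite cardsU1 inE zC (lt_geF vz).
Qed.

End Rank.

(** * Reversal of polynomials *)

Section ReversePolynomial.
Local Open Scope ring_scope.
Implicit Types (p q : {poly int}) (m n : nat).

Lemma coef_revp n p i : (revp n p)`_i = if (i <= n)%N then p`_(n - i) else 0.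
Proof. by rewrite coef_poly ltnS. Qed.

Lemma revp_sum n (I : finType) (F : I -> {poly int}) :
  revp n (\sum_i F i) = \sum_i revp n (F i).
Proof.
apply/polyP => k; rewrite coef_revp !coef_sum; case: leqP => kn.
  by apply: eq_bigr => i _; rewrite coef_revp kn.
by rewrite big1 // => i _; rewrite coef_revp leqNgt kn.
Qed.

Lemma revp_monomial n (c : int) k :
  (k <= n)%N -> revp n (c *: 'X^k) = c *: 'X^(n - k).
Proof.
move=> kn; apply/polyP => i; rewrite coef_revp !coefZ !coefXn.
case: leqP => ni; first by congr (_ * _%:R); congr (nat_of_bool _); lia.
by rewrite (_ : (i == _) = false) ?mulr0 //; lia.
Qed.

Lemma poly_def_le n p : (size p <= n.+1)%N -> p = \sum_(i < n.+1) p`_i *: 'X^i.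
Proof.
move=> sp; rewrite -poly_def; apply/polyP => i; rewrite coef_poly.
by case: ltnP => // ni; rewrite nth_default // (leq_trans sp).
Qed.

Lemma revpE n p :
  (size p <= n.+1)%N -> revp n p = \sum_(i < n.+1) p`_i *: 'X^(n - i).
Proof.
move=> sp; rewrite {1}(poly_def_le sp) revp_sum.
by apply: eq_bigr => i _; rewrite revp_monomial // -ltnS.
Qed.

(** With p and q expanded into monomials, this is (m - i) + (n - j) = (m + n) - (i + j). *)
Lemma revpM m n p q : (size p <= m.+1)%N -> (size q <= n.+1)%N ->
  revp (m + n) (p * q) = revp m p * revp n q.
Proof.
move=> sp sq; rewrite (revpE sp) (revpE sq).
rewrite {1}(poly_def_le sp) {1}(poly_def_le sq).
rewrite !big_distrlr /= !pair_big /= revp_sum; apply: eq_bigr => -[[i im] [j jn]] _ /=.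
have e a b (u v : nat) :
    (a *: 'X^u) * (b *: 'X^v) = (a * b) *: 'X^(u + v) :> {poly int}.
  by rewrite -scalerAl -scalerAr scalerA exprD.
rewrite !e revp_monomial; last by lia.
by congr (_ *: 'X^_); lia.
Qed.

(** This is what makes KLS functions unique: the coefficients of revp n p live
    in degrees > n/2 and those of p in degrees < n/2, so they do not interfere
    in the difference. *)
Lemma revp_sub_inj n p q :
  (2 * (size p).-1 < n)%N -> (2 * (size q).-1 < n)%N ->
  revp n p - p = revp n q - q -> p = q.
Proof.
move=> sp sq E; apply/polyP => i.
have high (r : {poly int}) : (2 * (size r).-1 < n)%N -> (n <= 2 * i)%N -> r`_i = 0.
  move=> sr ni; have ri : (size r <= i)%N by lia.
  exact: nth_default ri.
have low (r : {poly int}) : (2 * (size r).-1 < n)%N -> (2 * i < n)%N -> (revp n r - r)`_i = - r`_i.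
  move=> sr ni; rewrite coefB coef_revp (_ : (i <= n)%N); last by lia.
  have ri : (size r <= n - i)%N by lia.
  by rewrite (nth_default _ ri) sub0r.
case: (leqP n (2 * i)) => ni; first by rewrite !high.
by apply: oppr_inj; rewrite -!low // E.
Qed.

End ReversePolynomial.

(** * The poset of intervals and its rank function *)

Section Intervals.
Context {d : Order.disp_t} {P : finTBPOrderType d}.
Implicit Types (s t u v w z : P) (A : intervals P).

Lemma is_closed_cinterval s t : is_closed_interval (cinterval s t).
Proof.
rewrite /is_closed_interval; have [st|Nst] := boolP (s <= t).
  by apply/orP; right; apply/existsP; exists s; apply/existsP; exists t; rewrite st /=.
apply/orP; left; apply/eqP/setP => x; rewrite !inE.
by apply: contraNF Nst => /andP[]; apply: le_trans.
Qed.

(** Total in s and t: when s <= t fails this is the empty interval, so statements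
    about nonempty intervals carry the hypothesis s <= t. *)
Definition itv s t : intervals P := ClosedInterval (is_closed_cinterval s t).

Lemma itv01 : itv \bot \top = \bot.
Proof. exact: val_inj. Qed.

Lemma itv_le s t u v : u <= v -> (itv s t <= itv u v) = (s <= u) && (v <= t).
Proof.
move=> uv; apply/idP/idP => [/subsetP sub|/andP[su vt]].
  have := sub u; have := sub v; rewrite !inE !lexx uv /=.
  by move=> /(_ isT) /andP[_ ->] /(_ isT) /andP[-> _].
apply/subsetP => x; rewrite !inE => /andP[ux xv].
by rewrite (le_trans su ux) (le_trans xv vt).
Qed.

Lemma itv_inj s t u v : s <= t -> u <= v -> itv s t = itv u v -> (s, t) = (u, v).
Proof.
move=> st uv E; have := lexx (itv s t); rewrite {1}E itv_le // => /andP[us tv].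
have := lexx (itv s t); rewrite {2}E itv_le // => /andP[su vt].
by congr pair; apply: le_anti; apply/andP.
Qed.

Lemma itv_neq1 s t : s <= t -> itv s t != \top.
Proof.
move=> st; apply/eqP => E; have : s \in interval_set (itv s t).
  by rewrite inE lexx.
by rewrite E inE.
Qed.

Lemma interval_eq A : A != \top -> exists s t, s <= t /\ A = itv s t.
Proof.
case/orP: (interval_setP A) => [/eqP A0|].
  by case/eqP; apply: val_inj.
move=> /existsP[s] /existsP[t] /andP[st /eqP AE] _; exists s, t; split=> //.
exact: val_inj.
Qed.

(** Junk on the empty interval: only its values on nonempty intervals matter. *)
Definition endpoints A : P * P :=
  odflt (\bot, \top) [pick p : P * P | (p.1 <= p.2) && (A == itv p.1 p.2)].

Lemma endpoints_itv s t : s <= t -> endpoints (itv s t) = (s, t).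
Proof.
move=> st; rewrite /endpoints; case: pickP => [[u v] /= /andP[uv /eqP E]|].
  by rewrite (itv_inj st uv E).
by move/(_ (s, t)); rewrite /= st eqxx.
Qed.

Lemma sum_intervals (Q : pred (intervals P)) (F : intervals P -> {poly int}) :
  (\sum_(A | Q A && (A != \top)) F A =
   \sum_(p : P * P | (p.1 <= p.2)%O && Q (itv p.1 p.2)) F (itv p.1 p.2))%R.
Proof.
rewrite (reindex_onto (fun p => itv p.1 p.2) endpoints) /=; last first.
  by move=> A /andP[_ /interval_eq[s [t [st ->]]]]; rewrite endpoints_itv.
apply: eq_bigl => -[s t] /=; have [st|Nst] := boolP (s <= t).
  by rewrite endpoints_itv // eqxx itv_neq1 // !andbT.
apply/negP => /andP[/andP[_ /interval_eq[u [v [uv ->]]]]].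
by rewrite endpoints_itv // => /eqP[us vt]; rewrite -us -vt uv in Nst.
Qed.

Definition interval_rank A : nat :=
  if A == \top then (rank (\top : P)).+1
  else rank (endpoints A).1 + (rank (\top : P) - rank (endpoints A).2).

Lemma interval_rank_itv s t : s <= t ->
  interval_rank (itv s t) = (rank s + (rank (\top : P) - rank t))%N.
Proof. by move=> st; rewrite /interval_rank (negPf (itv_neq1 st)) endpoints_itv. Qed.

(** Predecessors, in the sense of [rank_unique]: the empty interval sits above
    the singleton of the top element; [u, v] is obtained by cutting a longer
    interval at its lower end if u is not the bottom element, and at its upper
    end otherwise. *)
Lemma rank_intervals : graded P -> interval_rank =1 rank.
Proof.
move=> gP; apply: rank_unique.
- by rewrite -itv01 interval_rank_itv ?le0x // rank0 subnn.
- move=> A B AB; have A1 : A != \top by rewrite -ltx1 (lt_le_trans AB) // lex1.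
  have [s [t [st AE]]] := interval_eq A1; rewrite AE interval_rank_itv //.
  have rst := rank_le st; have rt1 := rank_le (lex1 t).
  have [->|/interval_eq[u [v [uv BE]]]] := eqVneq B \top.
    by rewrite /interval_rank eqxx; lia.
  move: AB; rewrite BE interval_rank_itv // AE lt_neqAle itv_le //.
  have ruv := rank_le uv; have rv1 := rank_le (lex1 v).
  case/andP=> neq /andP[]; rewrite !le_eqVlt.
  case/predU1P=> [su|/rank_lt su] /predU1P[vt|/rank_lt vt]; try by subst; lia.
  by rewrite su vt eqxx in neq.
- move=> A A0; have [->|/interval_eq[u [v [uv AE]]]] := eqVneq A \top.
    exists (itv \top \top); first by rewrite ltx1 itv_neq1.
    by rewrite interval_rank_itv // subnn addn0 /interval_rank eqxx.
  have [u0|/rank_pred[w wu rw]] := eqVneq u \bot.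
    have v1 : v != \top by apply: contraNneq A0 => v1; rewrite AE u0 v1 itv01.
    have [z vz rz] := rank_succ gP v1.
    have uz : u <= z by rewrite u0 le0x.
    exists (itv u z).
      rewrite AE lt_neqAle itv_le // lexx ltW // !andbT.
      by apply/eqP => /(itv_inj uz uv)[zv]; rewrite zv ltxx in vz.
    rewrite AE !interval_rank_itv //.
    by have := rank_le (lex1 z); lia.
  have wv : w <= v by apply: le_trans uv; apply: ltW.
  exists (itv w v); last by rewrite AE !interval_rank_itv // rw; lia.
  rewrite AE lt_neqAle itv_le // lexx ltW // !andbT.
  by apply/eqP => /(itv_inj wv uv)[uw]; rewrite uw ltxx in wu.
Qed.

Lemma rk_itv s t u v : graded P -> s <= u -> u <= v -> v <= t ->
  rk (itv s t) (itv u v) = (rk s u + rk v t)%N.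
Proof.
move=> gP su uv vt; have st := le_trans su (le_trans uv vt).
rewrite /rk -!rank_intervals // !interval_rank_itv //.
have := rank_le su; have := rank_le uv; have := rank_le vt.
by have := rank_le (lex1 t); lia.
Qed.

Lemma rk_itv1 u v : graded P -> u <= v -> rk (itv u v) \top = (rk u v).+1.
Proof.
move=> gP uv; rewrite /rk -!rank_intervals // interval_rank_itv //.
rewrite /interval_rank eqxx.
by have := rank_le uv; have := rank_le (lex1 v); lia.
Qed.

End Intervals.

(** * Kazhdan-Lusztig-Stanley functions of the poset of intervals *)

Section KLS.
Context {d : Order.disp_t} {P : finTBPOrderType d}.
Implicit Types (a : incidence P) (s t u v : P).
Local Open Scope ring_scope.

Lemma rkxx s : rk s s = 0%N.
Proof. exact: subnn. Qed.

Lemma rk_itv_lt s u v t w z : (s <= w <= u)%O -> (v <= z <= t)%O ->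
  (w < u)%O || (v < z)%O -> (rk s w + rk z t < rk s u + rk v t)%N.
Proof.
move=> /andP[/rank_le sw /rank_le wu] /andP[/rank_le vz /rank_le zt].
by rewrite /rk => /orP[/rank_lt|/rank_lt]; lia.
Qed.

(** Extends the strict degree bound to s = t, where it becomes the equality
    0 = 0; this makes the bounds of two factors add up. *)
Lemma kls_degree a s t : kls_normalized a -> (s <= t)%O ->
  (2 * (size (a s t)).-1 <= rk s t ?= iff (s == t))%N.
Proof.
move=> [_ a1 adeg]; rewrite le_eqVlt => /predU1P[<-|st].
  by apply/leqifP; rewrite eqxx a1 size_poly1 rkxx.
by apply/leqifP; rewrite lt_eqF // adeg.
Qed.

Lemma size_kls_mul (a b : incidence P) s u v t :
  kls_normalized a -> kls_normalized b -> (s <= u)%O -> (v <= t)%O ->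
  (s < u)%O || (v < t)%O ->
  (2 * (size (a s u * b v t)%R).-1 < rk s u + rk v t)%N.
Proof.
move=> na nb su vt lt; have := size_polyMleq (a s u) (b v t).
have /leqifP := kls_degree na su; have /leqifP := kls_degree nb vt.
by move: lt; rewrite !lt_neqAle su vt !andbT; do 2!case: eqP => _ //=; lia.
Qed.

End KLS.

Section LeftKLSIntervals.
Context {d : Order.disp_t} {P : finTBPOrderType d}.
Context (f g : incidence P) (ghat : incidence (intervals P)).
Context (gP : graded P).
Context (fP : is_right_kls (eulerian_kernel P) f).
Context (gKLS : is_left_kls (eulerian_kernel P) g).
Context (ghatP : is_left_kls (eulerian_kernel (intervals P)) ghat).
Implicit Types (s t u v : P).
Local Open Scope ring_scope.

(** The recursion that characterizes left KLS functions, for the product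
    g_(s, u) f_(v, t): multiply g^rev = g eps by f^rev = eps f. *)
Lemma revp_kls_mul s u v t : (s <= u)%O -> (v <= t)%O ->
  revp (rk s u + rk v t) (g s u * f v t) =
  \sum_(p : P * P | (s <= p.1 <= u)%O && (v <= p.2 <= t)%O)
     g s p.1 * f p.2 t * ('X - 1) ^+ (rk p.1 u + rk v p.2).
Proof.
have [[Ig _ _] Eg] := gKLS; have [[If _ _] Ef] := fP => su vt.
rewrite revpM ?Ig ?If // -[revp _ _]/(inc_rev g s u) -[revp _ (f _ _)]/(inc_rev f v t).
rewrite Eg // Ef // /conv big_distrlr pair_big /=.
by apply: eq_bigr => p _; rewrite /eulerian_kernel exprD [_ * f _ _]mulrC mulrACA.
Qed.

(** Induction on the rank of [u, v] over [s, t].  Both sides obey the same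
    recursion, whose terms other than that of [u, v] itself agree by induction;
    so they have the same difference between reversal and value, and
    [revp_sub_inj] applies. *)
Lemma left_kls_itv s t u v : (s <= u)%O -> (u <= v)%O -> (v <= t)%O ->
  ghat (itv s t) (itv u v) = g s u * f v t.
Proof.
have [nghat Eghat] := ghatP; have [_ ghat1 ghatdeg] := nghat.
have [ng _] := gKLS; have [nf _] := fP.
have [n] := ubnP (rk s u + rk v t).
elim: n u v => // n IHn u v ltn su uv vt; have st := le_trans su (le_trans uv vt).
have [/andP[/eqP us /eqP vt']|neq] := boolP ((s == u) && (v == t)).
  have [_ f1 _] := nf; have [_ g1 _] := ng.
  by rewrite -us vt' ghat1 f1 g1 mulr1.
have lt : (s < u)%O || (v < t)%O.
  by move: neq; rewrite negb_and !lt_neqAle su vt !andbT.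
have leJ : (itv s t <= itv u v)%O by rewrite itv_le // su vt.
apply: (@revp_sub_inj (rk s u + rk v t)); last 1 first.
- rewrite revp_kls_mul // -(rk_itv gP) // -[revp _ _]/(inc_rev ghat _ _) Eghat //.
  (* The recursion for ghat, indexed by the endpoints of the intervals between
     [s, t] and [u, v] *)
  have -> : conv ghat (eulerian_kernel _) (itv s t) (itv u v) =
      \sum_(p : P * P | (s <= p.1 <= u)%O && (v <= p.2 <= t)%O)
     ghat (itv s t) (itv p.1 p.2) * ('X - 1) ^+ (rk p.1 u + rk v p.2).
    rewrite /conv (eq_bigl (fun A =>
        (itv s t <= A <= itv u v)%O && (A != \top%O))); last first.
      move=> A; case: eqVneq => [->|_]; rewrite ?andbT // andbF lex1.
      by apply: contraTF (itv_neq1 uv) => le1; rewrite negbK -le1x.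
    rewrite sum_intervals; apply: eq_big => [p|p].
      case: (boolP (p.1 <= p.2)%O) => [p12|/negP Np12].
        by rewrite !itv_le //=; do !case: (_ <= _)%O.
      apply/esym/negP => /andP[/andP[_ pu] /andP[vp _]]; case: Np12.
      exact: le_trans pu (le_trans uv vp).
    move=> /andP[p12]; rewrite !itv_le // => /andP[_ /andP[pu vp]].
    by rewrite /eulerian_kernel rk_itv.
  have in_uv : (s <= (u, v).1 <= u)%O && (v <= (u, v).2 <= t)%O.
    by rewrite /= su vt !lexx.
  (* Isolate the term of [u, v], where the kernel is 1 *)
  rewrite (bigD1 (u, v)) // [in RHS](bigD1 (u, v)) //= !rkxx expr0 !mulr1.
  rewrite ![_ + \sum_(_ | _) _]addrC !addrK.
  apply: eq_bigr => -[w z] /= /andP[/andP[/andP[sw wu] /andP[vz zt]] wz].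
  rewrite IHn //; last by apply: le_trans wu (le_trans uv vz).
  rewrite -ltnS; apply: leq_trans ltn; rewrite ltnS.
  apply: rk_itv_lt; rewrite ?sw ?vz // !lt_neqAle wu vz !andbT.
  by move: wz; rewrite -pair_eqE /= negb_and [v == z]eq_sym.
- rewrite -(rk_itv gP) //; apply: ghatdeg; rewrite lt_neqAle leJ andbT.
  apply: contraNneq neq => /(itv_inj st uv)[-> ->]; by rewrite !eqxx.
- exact: size_kls_mul.
Qed.

Lemma Z_polyE :
  Z_poly g f = \sum_(p : P * P | (p.1 <= p.2)%O)
    g \bot%O p.1 * ('X - 1) ^+ rk p.1 p.2 * f p.2 \top%O.
Proof.
have [_ Eg] := gKLS; rewrite /Z_poly /Z_function /conv.
rewrite -(pair_big_dep xpredT (fun s t => (s <= t)%O)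
  (fun s t => g \bot%O s * ('X - 1) ^+ rk s t * f t \top%O)) /=.
rewrite (exchange_big_dep xpredT) //=.
apply: eq_big => [w|w _]; first by rewrite le0x lex1.
by rewrite Eg ?le0x // /conv mulr_suml; apply: eq_bigl => s; rewrite le0x.
Qed.

Lemma left_kls_rev_sub :
  inc_rev ghat \bot%O \top%O - ghat \bot%O \top%O = Z_poly g f * ('X - 1).
Proof.
have [_ Eghat] := ghatP; rewrite Eghat ?le0x // /conv.
(* The term of the empty interval is ghat_(0, 1), which the left side subtracts *)
rewrite (bigD1 \top%O) ?lexx ?le0x //= [eulerian_kernel _ \top%O _]/eulerian_kernel rkxx expr0 mulr1.
rewrite addrAC subrr add0r sum_intervals Z_polyE mulr_suml.
apply: eq_big => [p|p /andP[p12 _]]; first by rewrite le0x lex1 !andbT.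
rewrite -itv01 left_kls_itv ?le0x ?lex1 // /eulerian_kernel rk_itv1 // exprSr.
by rewrite mulrA [_ * f _ _ * _]mulrAC.
Qed.

End LeftKLSIntervals.

Theorem theorem1p2 (d : Order.disp_t) (P : finTBPOrderType d)
    (f g : incidence P) (ghat : incidence (intervals P)) :
  eulerian P ->
  is_right_kls (eulerian_kernel P) f ->
  is_left_kls (eulerian_kernel P) g ->
  is_left_kls (eulerian_kernel (intervals P)) ghat ->
  Z_poly g f = toric_h ghat.
Proof.
move=> [gP _] fP gKLS ghatP.
rewrite /toric_h (left_kls_rev_sub gP fP gKLS ghatP).
by rewrite Pdiv.IdomainMonic.mulpK // monicXsubC.
Qed.
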